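(* Let $N\ge 0$, $L\ge 2$ and $1\le l_A\le L-1$ be integers, put $l_B=L-l_A$, and let $\mathcal H_N$ be the $N$-particle bosonic Fock space of $L$ modes described in the context. Let $\rho$ be a density operator on $\mathcal H_N$ with eigenvalues $p_1\ge p_2\ge\dots\ge p_{d_{AB}}$ listed with multiplicity, where $d_{AB}=\dim\mathcal H_N=\binom{N+L-1}{L-1}$. Order the $N+1$ sectors $\mathcal H_{A,n_A}\otimes\mathcal H_{B,N-n_A}$, $n_A=0,\dots,N$, as $k=0,1,\dots,N$ so that $d_{A,0}\ge d_{A,1}\ge\dots\ge d_{A,N}$, where $d_{A,k}$ and $d_{B,k}$ are the dimensions of the $A$-factor and the $B$-factor of the $k$-th sector, and $d_k=d_{A,k}d_{B,k}$. Partition the decreasingly ordered eigenvalues into consecutive groups: group $0$ consists of the first $d_0$ eigenvalues, group $1$ of the next $d_1$, and so on. Write $p_{k,1}\ge p_{k,2}\ge\dots\ge p_{k,d_k}$ for the eigenvalues in group $k$. Thus every eigenvalue in group $k$ is at least every eigenvalue in group $k+1$. For $b=1,\dots,d_{B,k}$ set $$q_{k,b}=\sum_{a=1}^{d_{A,k}} p_{k,(b-1)d_{A,k}+a}.$$ Then $$\min_{U}\, S\big(\operatorname{Tr}_A(U\rho U^\dagger)\big)=-\sum_{k=0}^{N}\sum_{b=1}^{d_{B,k}} q_{k,b}\log q_{k,b},$$ where the minimum is over all unitary operators $U$ on $\mathcal H_N$, i.e. all unitaries on the Fock space that commute with the total number operator, restricted to $\mathcal H_N$.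
   Context: There are $L$ bosonic modes (sites) with annihilation operators $\hat b_i$ and number operators $\hat n_i=\hat b_i^\dagger\hat b_i$, $i=1,\dots,L$. Subsystem $A$ consists of modes $1,\dots,l_A$ and subsystem $B$ of modes $l_A+1,\dots,L$. $\mathcal H_N$ is the span of the occupation-number basis states $|n_1,\dots,n_L\rangle$ with $\sum_i n_i=N$. It decomposes as $\mathcal H_N=\bigoplus_{n_A=0}^{N}\mathcal H_{A,n_A}\otimes\mathcal H_{B,N-n_A}$. Here $\mathcal H_{A,n}$ is spanned by the states $|n_1,\dots,n_{l_A}\rangle_A$ with $\sum_{i\le l_A}n_i=n$, and has dimension $\binom{n+l_A-1}{l_A-1}$. Likewise $\mathcal H_{B,m}$ is spanned by the states $|n_{l_A+1},\dots,n_L\rangle_B$ with total number $m$, and has dimension $\binom{m+l_B-1}{l_B-1}$. The reduced state $\operatorname{Tr}_A$ is the partial trace over the modes of $A$, taken in the usual Fock space of $A$ and $B$. Equivalently, $\operatorname{Tr}_A\sigma=\bigoplus_{m}\operatorname{Tr}_{\mathcal H_{A,N-m}}\big(\text{diagonal block of }\sigma\text{ on }\mathcal H_{A,N-m}\otimes\mathcal H_{B,m}\big)$. $S(\sigma)=-\operatorname{Tr}\sigma\log\sigma$ is the von Neumann entropy, with a fixed logarithm base and the convention $0\log 0=0$. *)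

(* Defs.v *)
From HB Require Import structures.
From mathcomp Require Import all_boot all_order all_algebra all_fingroup.
From mathcomp Require Import complex.
From mathcomp Require Import reals exp.
Set Implicit Arguments. Unset Strict Implicit. Unset Printing Implicit Defensive.
Import Order.TTheory GRing.Theory Num.Theory.
Local Open Scope ring_scope.
Local Open Scope sesquilinear_scope.

(* Occupation-number basis of H_N: functions n : 'I_L -> 'I_N.+1 (occupation of
   each of the L modes) with total occupation N.  Operators on H_N are
   matrices indexed by 'I_#|occset L N|, the basis state of index x being
   enum_val x. *)
Definition occset (L N : nat) : {set {ffun 'I_L -> 'I_N.+1}} :=
  [set f : {ffun 'I_L -> 'I_N.+1} | (\sum_i (f i : nat) == N)%N].

(* Occupation-number basis of the (relevant part of the) Fock space of B,
   bigoplus_{m=0}^N H_{B,m}: occupation functions on all L modes that vanish on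
   the modes of A (i < lA) and have total number <= N. *)
Definition Bset (lA L N : nat) : {set {ffun 'I_L -> 'I_N.+1}} :=
  [set f : {ffun 'I_L -> 'I_N.+1} | [forall i : 'I_L, (i < lA)%N ==> (f i == ord0)] &&
           (\sum_i (f i : nat) <= N)%N].

(* Partial trace over A (modes 0..lA-1):
   <b| Tr_A sigma |b'> = sum_a <a b| sigma |a b'>, where |a b> is the H_N basis
   state whose A-part is a and whose B-part is b (pairs (x, y) of H_N basis
   states with the same A-part, x having B-part b and y having B-part b'). *)
Definition ptrA_entry (R : realType) (lA L N : nat)
    (sigma : 'M[R[i]]_#|occset L N|) (b b' : 'I_#|Bset lA L N|) : R[i] :=
  let eb : {ffun 'I_L -> 'I_N.+1} := enum_val b in
  let eb' : {ffun 'I_L -> 'I_N.+1} := enum_val b' in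
  \sum_(x : 'I_#|occset L N|) \sum_(y : 'I_#|occset L N|)
    let ex : {ffun 'I_L -> 'I_N.+1} := enum_val x in
    let ey : {ffun 'I_L -> 'I_N.+1} := enum_val y in
    (if [forall i : 'I_L,
           if (i < lA)%N then ex i == ey i
           else (ex i == eb i) && (ey i == eb' i)]
     then sigma x y else 0).

Definition ptrA (R : realType) (lA L N : nat)
    (sigma : 'M[R[i]]_#|occset L N|) : 'M[R[i]]_#|Bset lA L N| :=
  \matrix_(b, b') ptrA_entry sigma b b'.

(* Functional calculus for normal matrices via the spectral decomposition
   A = P^-1 diag(lambda) P (P unitary), for a real function f applied to the
   real parts of the eigenvalues (used only for Hermitian matrices). *)
Definition mxfun (R : realType) (n : nat) (f : R -> R) (A : 'M[R[i]]_n)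
    : 'M[R[i]]_n :=
  invmx (spectralmx A)
    *m diag_mx (map_mx (fun z : R[i] => ((f (complex.Re z))%:C)%C)
                       (spectral_diag A))
    *m spectralmx A.

(* Logarithm in base b.  Note ln 0 = 0 in mathcomp-analysis, so that the
   convention 0 log 0 = 0 holds in the entropy below. *)
Definition logb (R : realType) (b x : R) : R := ln x / ln b.

Definition vN_entropy (R : realType) (b : R) (n : nat) (sigma : 'M[R[i]]_n)
    : R :=
  - complex.Re (\tr (sigma *m mxfun (logb b) sigma)).

Definition density_op (R : realType) (n : nat) (rho : 'M[R[i]]_n) : Prop :=
  [/\ rho ^t* = rho,
      forall v : 'cV[R[i]]_n, 0 <= (v ^t* *m rho *m v) 0 0
    & \tr rho = 1].

Definition dimA (lA nA : nat) : nat := 'C(nA + lA - 1, lA - 1).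
Definition dimB (lA L N nA : nat) : nat := 'C(N - nA + (L - lA) - 1, (L - lA) - 1).

(* The right-hand side.  s : {perm 'I_N.+1} orders the sectors: sector number k
   is the one with n_A = s k; ps is the decreasingly sorted eigenvalue list. *)
Definition min_entropy_formula (R : realType) (b : R) (lA L N : nat)
    (s : {perm 'I_N.+1}) (ps : seq R) : R :=
  let dA k := dimA lA (s k) in
  let dB k := dimB lA L N (s k) in
  let off (k : 'I_N.+1) := (\sum_(j < N.+1 | (j < k)%N) dA j * dB j)%N in
  let q k (bb : nat) := \sum_(a < dA k) nth 0 ps (off k + bb * dA k + a)%N in
  - \sum_(k < N.+1) \sum_(bb < dB k) q k bb * logb b (q k bb).

(* Main.v *)
(** The occupation basis of H_N embeds in the product of the occupation bases of
A and B, so H_N is a coordinate subspace of a tensor product.  If sigma has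
eigenvalues p_i and eigenbasis w_i, and Tr_A sigma has eigenvalues l_j and
eigenbasis v_j, then l_j = sum_i p_i D_ij with
D_ij = sum_a |<w_i|a,v_j>|^2 >= 0.  The rows of D sum to 1, and its j-th column
sums to sum_b |v_j(b)|^2 c_b, where c_b is the number of basis states of H_N with
B-part b.  As |v_j(b)|^2 is doubly stochastic, filling greedily twice bounds any
r of the l_j by the sum of the largest p_i, the number of these being the sum of
the r largest c_b.  Hence the list q majorizes l, and the entropy inequality is
Karamata's, which follows here from Gibbs' inequality and Abel summation.  The
bound is attained by sending the eigenvectors of rho, in decreasing order of
eigenvalue, to the basis states of H_N listed by B-part, the B-parts being listed
by decreasing c_b. *)
Require Import Defs.
From HB Require Import structures.
From mathcomp Require Import all_boot all_order all_algebra all_fingroup.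
From mathcomp Require Import complex.
From mathcomp Require Import reals exp.
From mathcomp Require Import ring lra zify.
Set Implicit Arguments.
Unset Strict Implicit.
Unset Printing Implicit Defensive.
Import Order.TTheory GRing.Theory Num.Theory.
Local Open Scope ring_scope.
Local Open Scope sesquilinear_scope.

(** * Majorization *)

(** Subtracting [p M] from every weight makes the weights nonnegative before [M] and nonpositive
    from [M] on, so the indicator of the first [M] indices is optimal. The mass bound and [0 <= p M]
    take care of the subtracted constant. *)
Lemma sum_le_prefix (R : numDomainType) (n M : nat) (p : nat -> R)
    (x : 'I_n -> R) :
  {homo p : i j / (i <= j)%N >-> j <= i} -> (forall i, 0 <= p i) ->
  (forall i, 0 <= x i <= 1) -> \sum_i x i <= M%:R -> (M <= n)%N ->
  \sum_(i < n) p i * x i <= \sum_(i < M) p i.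
Proof.
move=> p_noninc p_ge0 x01 sx leMn.
have -> : \sum_(i < M) p i =
    \sum_(i < n) (p i - p M) * (i < M)%N%:R + p M * M%:R.
  rewrite (eq_bigr (fun i : 'I_M => (p i - p M) + p M)); last first.
    by move=> i _; rewrite subrK.
  rewrite big_split /= sumr_const card_ord mulr_natr; congr (_ + _).
  rewrite (big_ord_widen n (fun i => p i - p M) leMn) big_mkcond /=.
  by apply: eq_bigr => i _; case: ifP => _; rewrite ?mulr1 ?mulr0.
apply: (@le_trans _ _ (\sum_(i < n) (p i - p M) * x i + p M * \sum_i x i)).
  rewrite mulr_sumr -big_split /= le_eqVlt; apply/orP; left; apply/eqP.
  by apply: eq_bigr => i _; rewrite -mulrDl subrK.
apply: lerD; last exact: ler_wpM2l.
apply: ler_sum => i _; have /andP[x0 x1] := x01 i.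
case: ltnP => [/ltnW leiM|leMi].
  by apply: ler_wpM2l => //; rewrite subr_ge0 p_noninc.
by rewrite mulr0 mulr_le0_ge0 // subr_le0 p_noninc.
Qed.

(** This is [ln t <= t - 1] at [t = l / q]. As [ln 0 = 0] here, the case [l = 0 < q] has to be
    excluded. *)
Lemma gibbs_term (R : realType) (q l : R) :
  0 <= q -> 0 <= l -> (l = 0 -> q = 0) -> q * ln l + q - l <= q * ln q.
Proof.
rewrite le_eqVlt => /predU1P[<-|q0]; first by rewrite !mul0r; lra.
rewrite le_eqVlt => /predU1P[<- /(_ erefl) q0'|l0 _]; first by lra.
have : ln (l / q) <= l / q - 1.
  by rewrite -{1}[l / q](subrKC 1) le_ln1Dx // ltrBrDl subrr divr_gt0.
rewrite ln_div // => /(ler_wpM2l (ltW q0)).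
have -> : q * (l / q - 1) = l - q by field; rewrite gt_eqF.
by rewrite mulrBr; lra.
Qed.

(** Karamata's inequality for [x ln x]. Gibbs' inequality reduces it to
    [\sum_i (q i - l i) * ln (l i) >= 0], which follows by Abel summation: the partial sums [S k] of
    [q - l] are nonnegative and [l] decreases. *)
Lemma sum_xlnx_majorize (R : realType) (n : nat) (l q : nat -> R) :
  {homo l : i j / (i <= j)%N >-> j <= i} ->
  (forall i, 0 <= l i) -> (forall i, 0 <= q i) ->
  (forall r, (r <= n)%N -> \sum_(i < r) l i <= \sum_(i < r) q i) ->
  \sum_(i < n) l i = \sum_(i < n) q i ->
  \sum_(i < n) l i * ln (l i) <= \sum_(i < n) q i * ln (q i).
Proof.
move=> l_noninc l_ge0 q_ge0 prefix total.
(* Once [l] vanishes at [i] its whole tail vanishes, so the first [i] terms of [q] already carry the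
   full total. *)
have q0 i : (i < n)%N -> l i = 0 -> q i = 0.
  move=> ltin li0.
  have tail (f : nat -> R) :
      \sum_(j < n) f j = \sum_(j < i) f j + \sum_(i <= j < n) f j.
    by rewrite -!(big_mkord xpredT) (big_cat_nat (n := i)) ?(ltnW ltin).
  have tl : \sum_(i <= j < n) l j = 0.
    apply: big1_seq => j; rewrite mem_index_iota => /andP[_ /andP[leij _]].
    by apply/eqP; rewrite eq_le l_ge0 andbT -li0 l_noninc.
  have := prefix i (ltnW ltin); move: total; rewrite !tail tl addr0 => ->.
  rewrite gerDl big_ltn // => le0; apply/eqP; rewrite eq_le q_ge0 andbT.
  by apply: le_trans le0; rewrite lerDl; apply: sumr_ge0.
pose S k := \sum_(i < k) (q i - l i).
have S_ge0 k : (k <= n)%N -> 0 <= S k.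
  by move=> lekn; rewrite /S sumrB subr_ge0 prefix.
(* Abel summation by induction on [k]. The value [ln 0 = 0] breaks the monotonicity of [ln (l i)],
   so [c] is compared only with indices where [l i > 0]; at the others [q i = l i = 0] and the term
   vanishes. *)
have abel k c : (k <= n)%N ->
    (forall i, (i < k)%N -> 0 < l i -> c <= ln (l i)) ->
    S k * c <= \sum_(i < k) (q i - l i) * ln (l i).
  elim: k c => [|k IHk] c lekn cP; first by rewrite /S !big_ord0 mul0r.
  have SS : S k.+1 = S k + (q k - l k) by rewrite /S big_ord_recr.
  rewrite big_ord_recr /=.
  have := l_ge0 k; rewrite le_eqVlt => /predU1P[/esym lk0|lk_gt0].
    rewrite SS lk0 (q0 k) // subrr !addr0 mul0r addr0.
    by apply: IHk => [|i ltik]; [exact: ltnW | apply: cP; rewrite ltnS ltnW].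
  apply: (@le_trans _ _ (S k.+1 * ln (l k))).
    by apply: ler_wpM2l; [exact: S_ge0 | apply: cP].
  rewrite SS mulrDl lerD2r; apply: IHk => [|i ltik li_gt0]; first exact: ltnW.
  by rewrite ler_ln ?posrE // l_noninc // ltnW.
(* Any lower bound of the logarithms serves as [c], since it gets multiplied by [S n = 0]. *)
have /(_ (- \sum_(i < n) `|ln (l i)|)) := abel n _ (leqnn n).
have -> : S n = 0 by rewrite /S sumrB total subrr.
rewrite mul0r => sum_ge0.
apply: (@le_trans _ _ (\sum_(i < n) (q i * ln (l i) + q i - l i))); last first.
  by apply: ler_sum => i _; apply: gibbs_term => //; apply: q0.
have -> : \sum_(i < n) (q i * ln (l i) + q i - l i) =
    \sum_(i < n) (q i - l i) * ln (l i) + \sum_(i < n) l i * ln (l i).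
  rewrite sumrB big_split /= -total addrK -big_split /=.
  by apply: eq_bigr => i _; rewrite mulrBl subrK.
rewrite lerDr; apply: sum_ge0 => i ltin _.
rewrite lerNl (bigD1 (Ordinal ltin)) //=.
apply: (@le_trans _ _ `|ln (l i)|); first by rewrite -normrN ler_norm.
by rewrite lerDl sumr_ge0.
Qed.

(** Greedy filling is applied twice. With weights [p], the fractions [\sum_(j in J) D i j] lie
    between 0 and 1. Their total mass is a combination of the [c r] whose coefficients
    [\sum_(j in J) W j r] lie between 0 and 1 and add up to [#|J|], so it is at most the sum of the
    first [#|J|] values of [c]. *)
Lemma transport_prefix (R : numDomainType) (n m : nat) (p : nat -> R)
    (c : nat -> nat) (D : 'I_n -> 'I_m -> R) (W : 'I_m -> 'I_m -> R)
    (J : {set 'I_m}) :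
  {homo p : i j / (i <= j)%N >-> j <= i} -> (forall i, 0 <= p i) ->
  {homo c : i j / (i <= j)%N >-> (j <= i)%N} -> (\sum_(r < m) c r)%N = n ->
  (forall i j, 0 <= D i j) -> (forall i, \sum_j D i j = 1) ->
  (forall j r, 0 <= W j r) -> (forall j, \sum_r W j r = 1) ->
  (forall r, \sum_j W j r = 1) ->
  (forall j, \sum_i D i j = \sum_(r < m) W j r * (c r)%:R) ->
  \sum_(j in J) \sum_(i < n) p i * D i j
    <= \sum_(i < \sum_(r < #|J|) c r) p i.
Proof.
move=> p_noninc p_ge0 c_noninc sum_c D0 D1 W0 W1 W1' DW.
have leJ : (#|J| <= m)%N by rewrite -[X in (_ <= X)%N]card_ord max_card.
have in01 (F : 'I_m -> R) : (forall j, 0 <= F j) -> \sum_j F j = 1 ->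
    0 <= \sum_(j in J) F j <= 1.
  move=> F0 <-; rewrite sumr_ge0 //= [leRHS](bigID (mem J)) /=.
  by rewrite lerDl sumr_ge0.
rewrite exchange_big /=.
rewrite (eq_bigr (fun i : 'I_n => p i * \sum_(j in J) D i j)); last first.
  by move=> i _; rewrite mulr_sumr.
apply: sum_le_prefix => // [i||]; first exact: in01.
- rewrite exchange_big /= (eq_bigr _ (fun j _ => DW j)) exchange_big /=.
  rewrite natr_sum.
  rewrite (eq_bigr (fun r : 'I_m => (c r)%:R * \sum_(j in J) W j r)); last first.
    by move=> r _; rewrite mulr_sumr; apply: eq_bigr => j _; rewrite mulrC.
  apply: (@sum_le_prefix _ _ _ (fun r => (c r)%:R)) => // [i j leij|i|].
  + by rewrite ler_nat c_noninc.
  + exact: in01.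
  by rewrite exchange_big /= (eq_bigr _ (fun j _ => W1 j)) sumr_const.
rewrite -[X in (_ <= X)%N]sum_c -!(big_mkord xpredT).
by rewrite [leqRHS](big_cat_nat (n := #|J|)) //= leq_addr.
Qed.

(** * Spectra of Hermitian matrices *)

Lemma unitarymxPl (C : numClosedFieldType) (n : nat) (V : 'M[C]_n) :
  V \is unitarymx -> V^t* *m V = 1%:M.
Proof. by move=> /unitarymxP; apply: mulmx1C. Qed.

Lemma unitarymx_row (C : numClosedFieldType) (n : nat) (V : 'M[C]_n) i j :
  V \is unitarymx -> \sum_k V i k * (V j k)^* = (i == j)%:R.
Proof.
move=> /unitarymxP/matrixP/(_ i j); rewrite !mxE => <-.
by apply: eq_bigr => k _; rewrite !mxE.
Qed.

Lemma unitarymx_col (C : numClosedFieldType) (n : nat) (V : 'M[C]_n) i j :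
  V \is unitarymx -> \sum_k (V k i)^* * V k j = (i == j)%:R.
Proof.
move=> /unitarymxPl/matrixP/(_ i j); rewrite !mxE => <-.
by apply: eq_bigr => k _; rewrite !mxE.
Qed.

Lemma char_poly_unitary_diag (C : numClosedFieldType) (n : nat) (V : 'M[C]_n)
    (d : 'rV[C]_n) :
  V \is unitarymx ->
  char_poly (V^t* *m diag_mx d *m V) = \prod_j ('X - (d 0 j)%:P).
Proof.
move=> /unitarymxPl VV.
have <- : char_poly (diag_mx d) = \prod_j ('X - (d 0 j)%:P).
  rewrite char_poly_trig ?diag_mx_is_trig //.
  by apply: eq_bigr => j _; rewrite !mxE eqxx mulr1n.
rewrite /char_poly /char_poly_mx !map_mxM /=.
have PP : map_mx (@polyC C) (V^t*) *m map_mx polyC V = 1%:M.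
  by rewrite -map_mxM /= VV map_mx1.
have -> : 'X%:M -
     map_mx polyC (V^t*) *m map_mx polyC (diag_mx d) *m map_mx polyC V =
   map_mx polyC (V^t*) *m ('X%:M - map_mx polyC (diag_mx d)) *m map_mx polyC V.
  by rewrite mulmxBr mulmxBl scalar_mxC -[in RHS](mulmxA _%:M) PP mulmx1.
by rewrite !det_mulmx mulrC mulrA -det_mulmx (mulmx1C PP) det1 mul1r.
Qed.

Lemma hermitian_spectral (C : numClosedFieldType) (n : nat) (A : 'M[C]_n) :
  A^t* = A ->
  A = (spectralmx A)^t* *m diag_mx (spectral_diag A) *m spectralmx A.
Proof.
move=> AA; have /orthomx_spectralP : A \is normalmx.
  by apply/normalmxP; rewrite AA.
by rewrite invmx_unitary ?spectral_unitarymx.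
Qed.

(** The order of [spectral_diag] is not under control; unique factorization of the characteristic
    polynomial fixes its entries up to permutation. *)
Lemma perm_eq_spectral_diag (C : numClosedFieldType) (n : nat) (A : 'M[C]_n)
    (s : seq C) :
  A^t* = A -> char_poly A = \prod_(x <- s) ('X - x%:P) ->
  perm_eq s [seq spectral_diag A 0 j | j : 'I_n].
Proof.
move=> AA As; apply: prod_XsubC_eq; rewrite -As {1}(hermitian_spectral AA).
rewrite char_poly_unitary_diag ?spectral_unitarymx //.
by rewrite big_map big_enum.
Qed.

Lemma vN_entropyE (R : realType) (b : R) (n : nat) (A : 'M[R[i]]_n) :
  A^t* = A ->
  vN_entropy b A =
    - \sum_j complex.Re (spectral_diag A 0 j) *
             logb b (complex.Re (spectral_diag A 0 j)).
Proof.
move=> AA; rewrite /vN_entropy /mxfun.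
rewrite {1}(hermitian_spectral AA) -invmx_unitary ?spectral_unitarymx //.
set S := spectralmx A; set d := spectral_diag A.
rewrite -!mulmxA (mulmxA S) mulmxV ?spectral_unit // mul1mx.
rewrite mxtrace_mulC -!mulmxA mulmxV ?spectral_unit // mulmx1.
rewrite mulmx_diag mxtrace_diag.
congr (- _); rewrite raddf_sum /=; apply: eq_bigr => j _.
rewrite !mxE; case: (d 0 j) => x y /=.
by rewrite mulr0 subr0.
Qed.

(** [spectralmx] of a diagonal matrix need not be the identity, but the entropy is a symmetric
    function of the eigenvalues. *)
Lemma vN_entropy_diag (R : realType) (b : R) (n : nat) (d : 'I_n -> R) :
  vN_entropy b (diag_mx (\row_j (d j)%:C)%C) = - \sum_j d j * logb b (d j).
Proof.
set A := diag_mx _.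
have AA : A^t* = A.
  rewrite /A tr_diag_mx map_diag_mx; congr diag_mx.
  by apply/rowP => j; rewrite !mxE; exact: conjc_real.
rewrite vN_entropyE //; congr (- _).
have /perm_eq_spectral_diag : char_poly A =
    \prod_(x <- [seq ((d j)%:C)%C | j : 'I_n]) ('X - x%:P).
  rewrite big_map big_enum /= char_poly_trig ?diag_mx_is_trig //.
  by apply: eq_bigr => j _; rewrite !mxE eqxx mulr1n.
move=> /(_ AA) sp_d.
transitivity (\sum_(x <- [seq spectral_diag A 0 j | j : 'I_n])
   complex.Re x * logb b (complex.Re x)); first by rewrite big_map big_enum.
by rewrite -(perm_big _ sp_d) big_map big_enum.
Qed.

(** The rows of [spectralmx A] are permuted so that the eigenvalues appear in the prescribed
    order. *)
Lemma unitary_diagonalization (C : numClosedFieldType) (n : nat) (A : 'M[C]_n)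
    (ds : seq C) :
  A^t* = A -> size ds = n -> char_poly A = \prod_(x <- ds) ('X - x%:P) ->
  exists2 W, W \is unitarymx &
    A = W^t* *m diag_mx (\row_(j < n) ds`_j) *m W.
Proof.
move=> AA szds /(perm_eq_spectral_diag AA).
move: szds => /eqP szds; pose tds := Tuple szds.
have -> : ds = tds by [].
have -> : [seq spectral_diag A 0 j | j : 'I_n] =
   [tuple spectral_diag A 0 j | j < n] by [].
move=> /tuple_permP[s dsE]; pose S := spectralmx A.
have W_unit : row_perm s S \is unitarymx.
  apply/unitarymxP/matrixP => i j; rewrite !mxE.
  under eq_bigr => k _ do rewrite !mxE.
  by rewrite unitarymx_row ?spectral_unitarymx // (inj_eq perm_inj).
exists (row_perm s S) => //.
rewrite {1}(hermitian_spectral AA); apply/matrixP => x y.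
rewrite !mxE (reindex_inj (@perm_inj _ s)); apply: eq_bigr => k _.
rewrite !mxE; congr (_ * _).
rewrite (bigD1 (s k)) //= big1 => [|i /negPf ne_i]; last first.
  by rewrite !mxE ne_i mulr0n mulr0.
rewrite [RHS](bigD1 k) //= [in RHS]big1 => [|i /negPf ne_i]; last first.
  by rewrite !mxE ne_i mulr0n mulr0.
rewrite !mxE !eqxx !mulr1n !addr0; congr (_ * _).
rewrite -[RHS]/(nth 0 (tval tds) k) dsE (nth_map k) ?size_enum_ord //.
by rewrite nth_ord_enum tnth_mktuple.
Qed.

(** * Partial trace on a coordinate subspace of a tensor product *)

(** Basis state [x] stands for the product state with A-part [alpha x] and B-part [beta x]. When
    these two determine [x], this is the usual partial trace over A of [sigma] extended by zero. *)
Definition partial_trace (C : numClosedFieldType) (n m : nat) (T : finType)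
    (alpha : 'I_n -> T) (beta : 'I_n -> 'I_m) (sigma : 'M[C]_n) : 'M[C]_m :=
  \matrix_(b, b') \sum_x \sum_y
    (if [&& alpha x == alpha y, beta x == b & beta y == b'] then sigma x y
     else 0).

Lemma partial_trace_herm (C : numClosedFieldType) (n m : nat) (T : finType)
    (alpha : 'I_n -> T) (beta : 'I_n -> 'I_m) (sigma : 'M[C]_n) :
  sigma^t* = sigma ->
  (partial_trace alpha beta sigma)^t* = partial_trace alpha beta sigma.
Proof.
move=> /matrixP sigmaT; apply/matrixP => b b'; rewrite !mxE exchange_big /=.
rewrite rmorph_sum; apply: eq_bigr => x _; rewrite rmorph_sum.
apply: eq_bigr => y _; rewrite eq_sym [X in _ && X]andbC.
by case: ifP => _; rewrite ?rmorph0 // -[in RHS]sigmaT !mxE.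
Qed.

Lemma partial_trace_diag (C : numClosedFieldType) (n m : nat) (T : finType)
    (alpha : 'I_n -> T) (beta : 'I_n -> 'I_m) (d : 'I_n -> C) :
  partial_trace alpha beta (diag_mx (\row_x d x)) =
  diag_mx (\row_b \sum_(x | beta x == b) d x).
Proof.
apply/matrixP => b b'; rewrite !mxE.
transitivity (\sum_x if (beta x == b) && (beta x == b') then d x else 0).
  apply: eq_bigr => x _; rewrite (bigD1 x) //= big1 => [|y /negPf ne_yx].
    by rewrite !mxE !eqxx addr0 mulr1n.
  by rewrite !mxE (eq_sym x) ne_yx mulr0n if_same.
rewrite -big_mkcond /=; case: eqP => [<-|ne_b].
  by rewrite mulr1n; apply: eq_bigl => x; rewrite andbb.
rewrite mulr0n big1 // => x /andP[/eqP xb /eqP xb'].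
by case: ne_b; rewrite -xb.
Qed.

(** It links the constraint [alpha x == alpha y] of the partial trace to squared moduli, which are
    visibly nonnegative. *)
Lemma sum_fiber_sqr (C : numClosedFieldType) (I T : finType)
    (alpha : I -> T) (g : I -> C) :
  \sum_a `|\sum_(x | alpha x == a) g x| ^+ 2 =
  \sum_x \sum_(y | alpha x == alpha y) g x * (g y)^*.
Proof.
rewrite [RHS](partition_big alpha xpredT) //=; apply: eq_bigr => a _.
rewrite normCK rmorph_sum mulr_suml; apply: eq_bigr => x /eqP <-.
by rewrite mulr_sumr; apply: eq_bigl => y; rewrite eq_sym.
Qed.

(* The weight with which the [i]-th eigenvalue of [sigma] contributes to the
   [j]-th eigenvalue of its partial trace, [W] and [V] being the respective
   eigenbases. *)
Definition weight (C : numClosedFieldType) (n m : nat) (T : finType)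
    (alpha : 'I_n -> T) (beta : 'I_n -> 'I_m) (W : 'M[C]_n) (V : 'M[C]_m) i j :=
  \sum_a `|\sum_(x | alpha x == a) V j (beta x) * (W i x)^*| ^+ 2.

Section Weight.
Context (C : numClosedFieldType) (n m : nat) (T : finType).
Context (alpha : 'I_n -> T) (beta : 'I_n -> 'I_m) (W : 'M[C]_n) (V : 'M[C]_m).
Hypothesis W_unit : W \is unitarymx.
Hypothesis V_unit : V \is unitarymx.

Let D := weight alpha beta W V.

Lemma weight_ge0 i j : 0 <= D i j.
Proof. by apply: sumr_ge0 => a _; apply: exprn_ge0. Qed.

(** After summation over [j], orthonormality of the columns of [V] forces [beta x = beta y]. With
    [alpha x = alpha y] this gives [x = y], and the squared norm of row [i] of [W] remains. *)
Lemma weight_row i :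
  injective (fun x => (alpha x, beta x)) -> \sum_j D i j = 1.
Proof.
move=> ab_inj; transitivity (\sum_x W i x * (W i x)^*); last first.
  by rewrite unitarymx_row ?eqxx.
under eq_bigr => j _ do rewrite /D /weight sum_fiber_sqr.
rewrite exchange_big /=; apply: eq_bigr => x _; rewrite exchange_big /=.
transitivity (\sum_(y | alpha x == alpha y)
    (W i x)^* * W i y * (beta y == beta x)%:R).
  apply: eq_bigr => y _; rewrite -(unitarymx_col _ _ V_unit) // mulr_sumr.
  apply: eq_bigr => j _; rewrite rmorphM /= conjCK; ring.
rewrite (bigD1 x) //= eqxx mulr1 big1 ?addr0 ?(mulrC (W i x)) //.
move=> y /andP[/eqP axy ne_yx]; case: eqP => [bxy|]; last by rewrite mulr0.
by case/eqP: ne_yx; apply: ab_inj; rewrite axy bxy.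
Qed.

(** Here orthonormality of the columns of [W] alone forces [x = y]; the remaining squares are
    grouped by B-part. *)
Lemma weight_col j :
  \sum_i D i j = \sum_b `|V j b| ^+ 2 * #|[pred x | beta x == b]|%:R.
Proof.
transitivity (\sum_x V j (beta x) * (V j (beta x))^*).
  under eq_bigr => i _ do rewrite /D /weight sum_fiber_sqr.
  rewrite exchange_big /=; apply: eq_bigr => x _; rewrite exchange_big /=.
  transitivity (\sum_(y | alpha x == alpha y)
      V j (beta x) * (V j (beta y))^* * (x == y)%:R).
    apply: eq_bigr => y _; rewrite -(unitarymx_col _ _ W_unit) // mulr_sumr.
    apply: eq_bigr => i _; rewrite rmorphM /= conjCK; ring.
  rewrite (bigD1 x) //= eqxx mulr1 big1 ?addr0 // => y /andP[_ ne_yx].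
  by rewrite eq_sym (negPf ne_yx) mulr0.
rewrite (partition_big beta xpredT) //=; apply: eq_bigr => b _.
rewrite mulr_natr -sumr_const; apply: eq_big => [x|x /eqP ->] //.
by rewrite normCK.
Qed.

(** [d 0 j] is a diagonal entry of the partial trace in the basis [V]. It expands into a sum over
    pairs with equal A-part, which [sum_fiber_sqr] turns into weights. *)
Lemma partial_trace_eigenvalue (p : 'I_n -> C) (d : 'rV[C]_m) j :
  partial_trace alpha beta (W^t* *m diag_mx (\row_i p i) *m W) =
    V^t* *m diag_mx d *m V ->
  d 0 j = \sum_i p i * D i j.
Proof.
set A := partial_trace _ _ _ => AE.
have -> : d 0 j = (V *m A *m V^t*) j j.
  rewrite AE !mulmxA (unitarymxP V_unit) mul1mx -mulmxA (unitarymxP V_unit).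
  by rewrite mulmx1 !mxE eqxx mulr1n.
transitivity (\sum_x \sum_(y | alpha x == alpha y) \sum_i
    p i * (V j (beta x) * (W i x)^* * (V j (beta y) * (W i y)^*)^*)).
  rewrite mxE; under eq_bigr => b' _ do rewrite mxE mulr_suml.
  under eq_bigr => b' _ do under eq_bigr => b _ do
    rewrite !mxE mulr_sumr mulr_suml.
  rewrite exchange_big /=.
  under eq_bigr => b _ do rewrite exchange_big /=.
  rewrite exchange_big /=; apply: eq_bigr => x _.
  (* Only [b = beta x], and then [b' = beta y], contributes. *)
  rewrite (bigD1 (beta x)) //= [X in _ + X]big1 ?addr0; last first.
    move=> b /negPf ne_b; apply: big1 => b' _.
    rewrite mulr_sumr mulr_suml big1 // => y _.
    by rewrite (eq_sym (beta x)) ne_b andbF mulr0 mul0r.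
  under eq_bigr => b' _ do rewrite mulr_sumr mulr_suml.
  rewrite exchange_big [RHS]big_mkcond /=; apply: eq_bigr => y _.
  rewrite eqxx /= (bigD1 (beta y)) //= big1 ?addr0; last first.
    by move=> b' /negPf ne_b; rewrite (eq_sym (beta y)) ne_b !andbF mulr0 mul0r.
  rewrite eqxx andbT; case: ifP => _; last by rewrite mulr0 mul0r.
  rewrite !mxE mulr_sumr mulr_suml; apply: eq_bigr => i _.
  rewrite mul_mx_diag !mxE rmorphM /= conjCK; ring.
rewrite (eq_bigr (fun x => \sum_i \sum_(y | alpha x == alpha y)
    p i * (V j (beta x) * (W i x)^* * (V j (beta y) * (W i y)^*)^*))).
  rewrite exchange_big /=; apply: eq_bigr => i _.
  rewrite /D /weight sum_fiber_sqr mulr_sumr.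
  by apply: eq_bigr => x _; rewrite mulr_sumr.
by move=> x _; rewrite exchange_big.
Qed.

End Weight.

(** * Monotone sequences and sums over consecutive chunks *)

(** Past the end [nth] returns [x0], so monotonicity on all of [nat] requires [x0] to come after
    every entry. *)
Lemma sorted_nth_homo (T : eqType) (leT : rel T) (x0 : T) (s : seq T) :
  transitive leT -> reflexive leT -> {in s, forall x, leT x x0} ->
  sorted leT s -> {homo nth x0 s : i j / (i <= j)%N >-> leT i j}.
Proof.
move=> leT_tr leT_refl les0 s_sorted i j leij.
have [ltjs|lesj] := ltnP j (size s).
  by apply: sorted_leq_nth => //; rewrite inE // (leq_ltn_trans leij).
rewrite (nth_default _ lesj); have [ltis|lesi] := ltnP i (size s).
  exact/les0/mem_nth.
by rewrite nth_default.
Qed.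

(** When [c] lists the dimensions [d_{A,k}], each repeated [d_{B,k}] times, these are the numbers
    [q_{k,b}]. *)
Definition chunk_sum (R : nmodType) (p : nat -> R) (c : nat -> nat) (r : nat) :=
  \sum_(i < c r) p (\sum_(j < r) c j + i)%N.

Lemma sum_chunks (R : nmodType) (p : nat -> R) (c : nat -> nat) (k : nat) :
  \sum_(r < k) chunk_sum p c r =
  \sum_(i < \sum_(r < k) c r) p i.
Proof.
elim: k => [|k IHk]; first by rewrite !big_ord0.
by rewrite !big_ord_recr /= IHk big_split_ord.
Qed.

Lemma exists_antitone_perm (R : realDomainType) (m : nat) (l : 'I_m -> R) :
  (forall j, 0 <= l j) ->
  exists (t : {perm 'I_m}) (l' : nat -> R),
    [/\ forall r : 'I_m, l' r = l (t r),
        {homo l' : i j / (i <= j)%N >-> j <= i} & forall i, 0 <= l' i].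
Proof.
move=> l_ge0; pose geR (x y : R) := y <= x; pose s := [seq l j | j : 'I_m].
have sz : size (sort geR s) == m by rewrite size_sort size_map size_enum_ord.
have sE : [tuple l j | j < m] = s :> seq R by [].
have : perm_eq (Tuple sz) [tuple l j | j < m] by rewrite sE perm_sort.
move=> /tuple_permP[t tE].
have s_ge0 : {in sort geR s, forall x, 0 <= x}.
  by move=> x; rewrite mem_sort => /mapP[j _ ->].
exists t, (nth 0 (sort geR s)); split=> [r||i].
- rewrite -[sort geR s]/(tval (Tuple sz)) tE (nth_map r) ?size_enum_ord //.
  by rewrite nth_ord_enum tnth_mktuple.
- apply: (@sorted_nth_homo _ geR) => //.
  + by move=> x y z; rewrite /geR => xy /le_trans; apply.
  + by move=> x; rewrite /geR.
  by apply: sort_sorted => x y; rewrite /geR le_total.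
have [lti|lei] := ltnP i (size (sort geR s)); first exact/s_ge0/mem_nth.
by rewrite nth_default.
Qed.

(** * Minimal entropy of an abstract partial trace *)

Lemma sum_card_fibers (n m : nat) (beta : 'I_n -> 'I_m) (c : nat -> nat)
    (s : {perm 'I_m}) :
  (forall r : 'I_m, c r = #|[pred x | beta x == s r]|) ->
  (\sum_(r < m) c r)%N = n.
Proof.
move=> cE; rewrite (eq_bigr _ (fun r _ => cE r)).
rewrite -(reindex_inj (@perm_inj _ s)
   (P := xpredT) (F := fun r => #|[pred x | beta x == r]|)) /=.
rewrite -[RHS]card_ord -sum1_card (partition_big beta xpredT) //=.
by apply: eq_bigr => r _; rewrite sum1_card.
Qed.

(** [c] lists the fibre sizes of [beta] in decreasing order. Prefix sums of the chunk sums are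
    prefix sums of [p], so [transport_prefix] yields the majorization that [sum_xlnx_majorize] asks
    for. *)
Lemma vN_entropy_partial_trace_ge (R : realType) (b : R) (n m : nat)
    (T : finType) (alpha : 'I_n -> T) (beta : 'I_n -> 'I_m)
    (p : nat -> R) (c : nat -> nat) (s : {perm 'I_m}) (W : 'M[R[i]]_n) :
  1 < b -> injective (fun x => (alpha x, beta x)) -> W \is unitarymx ->
  {homo p : i j / (i <= j)%N >-> j <= i} -> (forall i, 0 <= p i) ->
  {homo c : i j / (i <= j)%N >-> (j <= i)%N} ->
  (forall r : 'I_m, c r = #|[pred x | beta x == s r]|) ->
  - \sum_(r < m) chunk_sum p c r * logb b (chunk_sum p c r) <=
  vN_entropy b (partial_trace alpha beta
    (W^t* *m diag_mx (\row_i ((p i)%:C)%C) *m W)).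
Proof.
move=> b_gt1 ab_inj W_unit p_noninc p_ge0 c_noninc cE; pose q := chunk_sum p c.
set sigma := W^t* *m _ *m W; set A := partial_trace _ _ _.
have A_herm : A^t* = A.
  apply: partial_trace_herm; rewrite /sigma !trmx_mul !map_mxM /= trmxCK.
  rewrite tr_diag_mx map_diag_mx mulmxA; congr (_ *m diag_mx _ *m _).
  by apply/rowP => j; rewrite !mxE; exact: conjc_real.
pose V := spectralmx A; pose d := spectral_diag A.
have V_unit : V \is unitarymx := spectral_unitarymx A.
pose D := weight alpha beta W V.
have dE j : d 0 j = \sum_(i < n) ((p i)%:C)%C * D i j.
  exact/partial_trace_eigenvalue/hermitian_spectral.
pose l j := complex.Re (d 0 j).
have d_ge0 j : 0 <= d 0 j.
  rewrite dE sumr_ge0 // => i _; rewrite mulr_ge0 ?ler0c //.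
  exact: weight_ge0.
have lE j : ((l j)%:C)%C = d 0 j by rewrite RRe_real // ger0_real.
have l_ge0 j : 0 <= l j by rewrite -ler0c lE.
have [t [l' [l'E l'_noninc l'_ge0]]] := exists_antitone_perm l_ge0.
have sum_c : (\sum_(r < m) c r)%N = n by apply: sum_card_fibers cE.
have prefix k : (k <= m)%N -> \sum_(i < k) l' i <= \sum_(i < k) q i.
  move=> lekm; rewrite sum_chunks.
  (* [J] indexes the [k] largest eigenvalues of the partial trace. *)
  pose J := t @: [set r : 'I_m | (r < k)%N].
  have sumJ : \sum_(i < k) l' i = \sum_(j in J) l j.
    rewrite big_imset /=; last by move=> ? ? _ _; apply: perm_inj.
    rewrite (big_ord_widen _ _ lekm) /=.
    by apply: eq_big => [r|r _]; rewrite ?inE ?l'E.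
  have cardJ : #|J| = k.
    rewrite card_imset; last exact: perm_inj.
    rewrite -[RHS]card_ord -!sum1_card (big_ord_widen _ (fun=> 1%N) lekm).
    by apply: eq_bigl => r; rewrite inE.
  rewrite sumJ -lecR !rmorph_sum /= (eq_bigr _ (fun j _ => lE j)).
  rewrite -{}cardJ (eq_bigr _ (fun j _ => dE j)).
  (* The squared moduli of a unitary matrix are doubly stochastic. Reordering the columns by [s]
     pairs column [r] with a fibre of size [c r]. *)
  apply: (@transport_prefix _ n m (fun i => ((p i)%:C)%C) c D
    (fun j r => `|V j (s r)| ^+ 2)) => //.
  - by move=> i j leij; rewrite lecR p_noninc.
  - by move=> i; rewrite ler0c.
  - exact: weight_ge0.
  - by move=> i; apply: weight_row.
  - by move=> j r; apply: exprn_ge0.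
  - move=> j; rewrite -(reindex_inj (@perm_inj _ s)
      (P := xpredT) (F := fun r => `|V j r| ^+ 2)) /=.
    under eq_bigr => r _ do rewrite normCK.
    by rewrite unitarymx_row ?eqxx.
  - move=> r; under eq_bigr => j _ do rewrite normCKC.
    by rewrite unitarymx_col ?eqxx.
  move=> j; rewrite (weight_col _ _ _ W_unit).
  rewrite (reindex_inj (@perm_inj _ s)) /=.
  by apply: eq_bigr => r _; rewrite cE.
have total : \sum_(i < m) l' i = \sum_(i < m) q i.
  apply: (@complexI R).
  rewrite sum_chunks sum_c !rmorph_sum /=.
  rewrite (eq_bigr (fun r => d 0 (t r))) => [|r _]; last by rewrite l'E lE.
  rewrite -(reindex_inj (@perm_inj _ t) (P := xpredT) (F := fun r => d 0 r)) /=.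
  rewrite (eq_bigr _ (fun j _ => dE j)) exchange_big /=.
  by apply: eq_bigr => i _; rewrite -mulr_sumr weight_row ?mulr1.
rewrite vN_entropyE // lerN2.
rewrite -/d (eq_bigr (fun j => l j * ln (l j) / ln b)); last first.
  by move=> j _; rewrite /logb mulrA.
rewrite [leRHS](eq_bigr (fun r : 'I_m => q r * ln (q r) / ln b)); last first.
  by move=> j _; rewrite /logb mulrA.
rewrite -!mulr_suml ler_pM2r ?invr_gt0 ?ln_gt0 //.
rewrite (reindex_inj (@perm_inj _ t)) /=.
rewrite (eq_bigr (fun r : 'I_m => l' r * ln (l' r))) => [|r _]; last first.
  by rewrite l'E.
apply: sum_xlnx_majorize => // i; exact: sumr_ge0.
Qed.

(** Basis states are numbered fibre by fibre, in the order [s], and [U] carries the [i]-th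
    eigenvector to the [i]-th basis state. The new state is diagonal, hence so is its partial trace,
    whose entries are the chunk sums. *)
Lemma vN_entropy_partial_trace_attained (R : realType) (b : R) (n m : nat)
    (T : finType) (alpha : 'I_n -> T) (beta : 'I_n -> 'I_m)
    (p : nat -> R) (c : nat -> nat) (s : {perm 'I_m}) (W : 'M[R[i]]_n) :
  W \is unitarymx ->
  (forall r : 'I_m, c r = #|[pred x | beta x == s r]|) ->
  exists2 U, U \is unitarymx &
  vN_entropy b (partial_trace alpha beta
    (U *m (W^t* *m diag_mx (\row_i ((p i)%:C)%C) *m W) *m U^t*)) =
  - \sum_(r < m) chunk_sum p c r * logb b (chunk_sum p c r).
Proof.
move=> W_unit cE.
pose off r := (\sum_(j < r) c j)%N.
pose fib r := enum [pred x | beta x == s r].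
pose rk x := (s^-1)%g (beta x).
have rkE x r : (beta x == s r) = (rk x == r).
  by rewrite /rk -(inj_eq (@perm_inj _ s)) permKV.
have fib_rk x : x \in fib (rk x) by rewrite mem_enum inE rkE.
have szfib r : size (fib r) = c r by rewrite -cardE cE.
(* The number of [x]: the size of all earlier fibres plus the position of [x] in its own. *)
pose f x := (off (rk x) + index x (fib (rk x)))%N.
have f_lt x : (f x < off (rk x).+1)%N.
  by rewrite /f /off big_ord_recr /= ltn_add2l -szfib index_mem.
have off_mono : {homo off : i j / (i <= j)%N}.
  move=> i j leij; rewrite /off -!(big_mkord xpredT c).
  by rewrite [leqRHS](big_cat_nat (n := i)) // leq_addr.
(* The intervals from [off r] to [off r.+1] are disjoint, so equal numbers force equal fibres. *)
have f_inj : injective f.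
  move=> x y fxy; have rkxy : rk x = rk y.
    have := f_lt x; have := f_lt y; rewrite -fxy.
    have fx_ge : (off (rk x) <= f x)%N by rewrite leq_addr.
    have fy_ge : (off (rk y) <= f x)%N by rewrite fxy leq_addr.
    move=> fx_lty fx_ltx; apply/val_inj/eqP; rewrite eqn_leq.
    apply/andP; split; rewrite leqNgt; apply/negP => /off_mono le_off.
      by have := leq_trans fx_lty (leq_trans le_off fx_ge); rewrite ltnn.
    by have := leq_trans fx_ltx (leq_trans le_off fy_ge); rewrite ltnn.
  move: fxy; rewrite /f rkxy => /addnI.
  by apply: (@index_inj _ _ (fib (rk y))); rewrite // -{1}rkxy.
have off_m : off m = n by apply: sum_card_fibers cE.
have f_ltn x : (f x < n)%N.
  by rewrite -off_m (leq_trans (f_lt x)) // off_mono.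
pose F x := Ordinal (f_ltn x).
have F_inj : injective F by move=> x y [] /f_inj.
(* With this choice, [U] times the adjoint of [W] is a permutation matrix. *)
pose U : 'M[R[i]]_n := \matrix_(x, y) W (F x) y.
have UWt : U *m W^t* = \matrix_(x, i) (F x == i)%:R.
  apply/matrixP => x i; rewrite !mxE -(unitarymx_row _ _ W_unit) //.
  by apply: eq_bigr => k _; rewrite !mxE.
have U_unit : U \is unitarymx.
  apply/unitarymxP/matrixP => x y; rewrite !mxE -(inj_eq F_inj).
  by rewrite -(unitarymx_row _ _ W_unit) //; apply: eq_bigr => k _; rewrite !mxE.
exists U => //.
have -> : U *m (W^t* *m diag_mx (\row_i ((p i)%:C)%C) *m W) *m U^t* =
    diag_mx (\row_x ((p (f x))%:C)%C).
  rewrite !mulmxA -mulmxA.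
  have -> : W *m U^t* = (U *m W^t*)^t*.
    by rewrite trmx_mul map_mxM /= trmxCK.
  rewrite UWt mul_mx_diag; apply/matrixP => x y; rewrite !mxE.
  rewrite (bigD1 (F x)) //= big1 => [|i ne_i]; last first.
    by rewrite !mxE (eq_sym (F x)) (negPf ne_i) !mul0r.
  rewrite !mxE eqxx mul1r addr0 (inj_eq F_inj) rmorph_nat mulr_natr.
  by rewrite eq_sym.
rewrite partial_trace_diag.
pose q' b' := chunk_sum p c ((s^-1)%g b').
have q'E b' : \sum_(x | beta x == b') p (f x) = q' b'.
  rewrite /q' /chunk_sum; set r := (s^-1)%g b'.
  rewrite -(big_mkord xpredT (fun i => p (off r + i)%N)).
  rewrite (eq_bigl (mem (fib r))) => [|x]; last first.
    by rewrite /fib /= mem_enum inE /r permKV.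
  rewrite -[RHS]/(\sum_(0 <= i < c r) p (off r + i)%N) -szfib.
  rewrite big_mkord.
  transitivity (\sum_(x <- fib r) p (off r + index x (fib r))%N).
    rewrite -big_uniq ?enum_uniq //=; apply: eq_big_seq => x.
    by rewrite mem_enum inE rkE /f => /eqP <-.
  (* [big_nth] needs a default basis state; for [n = 0] there is none, but then the fibres are
     empty. *)
  case: (posnP n) => [n0|n_gt0].
    rewrite big_tnth; apply: eq_bigr => i _; exfalso.
    by have := ltn_ord (tnth (in_tuple (fib r)) i); rewrite [X in (_ < X)%N]n0.
  rewrite (big_nth (Ordinal n_gt0)) big_mkord; apply: eq_bigr => i _.
  by rewrite index_uniq ?enum_uniq.
transitivity (vN_entropy b (diag_mx (\row_b' ((q' b')%:C)%C))).
  congr (vN_entropy b (diag_mx _)); apply/rowP => b'; rewrite !mxE.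
  by rewrite -q'E rmorph_sum.
rewrite vN_entropy_diag; congr (- _).
rewrite (reindex_inj (@perm_inj _ s)) /=; apply: eq_bigr => r _.
by rewrite /q' permK.
Qed.

(** * Occupation numbers *)

(** Stars and bars: [f] is free on [D] only, and its values along an enumeration of [D] form a tuple
    with sum [n]. Each of them is at most [n <= N], so passing between ['I_n.+1] and ['I_N.+1] loses
    nothing. *)
Lemma card_ffun_sum (I : finType) (D : {set I}) (N l n : nat)
    (g : {ffun I -> 'I_N.+1}) :
  #|D| = l.+1 -> (n <= N)%N ->
  #|[set f : {ffun I -> 'I_N.+1} |
       [forall i, (i \notin D) ==> (f i == g i)] &&
       (\sum_(i in D) (f i : nat) == n)%N]| = 'C(l + n, l).
Proof.
move=> cardD lenN; rewrite -card_ord_partitions.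
pose e (j : 'I_l.+1) : I := enum_val (cast_ord (esym cardD) j).
have e_inj : injective e by move=> j j' /enum_val_inj /cast_ord_inj.
have sumD (F : I -> nat) : (\sum_(i in D) F i = \sum_j F (e j))%N.
  rewrite big_enum_val (reindex (cast_ord (esym cardD))) //.
  by exists (cast_ord cardD) => j _; rewrite ?cast_ordK ?cast_ordKV.
have eD j : e j \in D by apply: enum_valP.
have Dx i : i \in D -> exists j, i = e j.
  move=> iD; exists (cast_ord cardD (enum_rank_in iD i)).
  by rewrite /e cast_ordK enum_rankK_in.
(* [k] inverts [e] on [D]; its default is never read, since [h] takes the value of [g] off [D]. *)
pose k i := odflt ord0 [pick j | e j == i].
have ek j : k (e j) = j.
  by rewrite /k; case: pickP => [j' /eqP/e_inj //|/(_ j)]; rewrite eqxx.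
pose h (t : l.+1.-tuple 'I_n.+1) : {ffun I -> 'I_N.+1} :=
  [ffun i => if i \in D then inord (tnth t (k i)) else g i].
have he t j : h t (e j) = tnth t j :> nat.
  rewrite ffunE eD ek inordK // (leq_trans (ltn_ord _)) // ltnS lenN //.
have h_inj : injective h.
  move=> t t' htt'; apply: eq_from_tnth => j; apply: val_inj => /=.
  by rewrite -!he htt'.
rewrite -(card_imset _ h_inj); apply: eq_card => f; rewrite inE.
apply/andP/imsetP => [[/forallP fg /eqP fsum]|[t]].
  have f_le j : (f (e j) <= n)%N.
    by rewrite -fsum sumD (bigD1 j) //= leq_addr.
  exists [tuple inord (f (e j)) | j < l.+1].
    rewrite inE big_tuple -[X in _ == X]fsum sumD; apply/eqP/eq_bigr => j _.
    by rewrite tnth_mktuple inordK // ltnS.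
  apply/ffunP => i; apply/val_inj => /=.
  have [/Dx[j ->]|iD] := boolP (i \in D).
    by rewrite he tnth_mktuple inordK // ltnS.
  by rewrite ffunE (negPf iD); have := fg i; rewrite iD => /eqP ->.
rewrite inE big_tuple => /eqP tn ->; split.
  by apply/forallP => i; apply/implyP => /negPf iD; rewrite ffunE iD.
by rewrite sumD -[X in _ == X]tn; apply/eqP/eq_bigr => j _; rewrite he.
Qed.

Section Fock.
Context (lA L N : nat).
Local Notation occ := {ffun 'I_L -> 'I_N.+1}.

(** Both parts remain functions on all [L] modes, zero on the other subsystem, to match the encoding
    of [Bset]. *)
Definition partA (f : occ) : occ :=
  [ffun i : 'I_L => if (i < lA)%N then f i else ord0].
Definition partB (f : occ) : occ :=
  [ffun i : 'I_L => if (i < lA)%N then ord0 else f i].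

Lemma partB_Bset f : f \in occset L N -> partB f \in Bset lA L N.
Proof.
rewrite !inE => /eqP sumf; apply/andP; split.
  by apply/forallP => i; apply/implyP => ltiA; rewrite ffunE ltiA.
by rewrite -[leqRHS]sumf; apply: leq_sum => i _; rewrite ffunE; case: ifP.
Qed.

Definition indexB (x : 'I_#|occset L N|) : 'I_#|Bset lA L N| :=
  enum_rank_in (partB_Bset (enum_valP x)) (partB (enum_val x)).

Lemma enum_val_indexB x : enum_val (indexB x) = partB (enum_val x).
Proof. by rewrite /indexB enum_rankK_in // partB_Bset // enum_valP. Qed.

Lemma Bset_lo (b : 'I_#|Bset lA L N|) (i : 'I_L) :
  (i < lA)%N -> enum_val b i = ord0.
Proof.
move=> ltiA; have := enum_valP b; rewrite inE => /andP[/forallP/(_ i)].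
by rewrite ltiA => /eqP.
Qed.

Lemma Bset_le (b : 'I_#|Bset lA L N|) : (\sum_i (enum_val b i : nat) <= N)%N.
Proof. by have := enum_valP b; rewrite inE => /andP[_]. Qed.

Lemma indexB_eq x b :
  (indexB x == b) =
  [forall i : 'I_L, (~~ (i < lA)%N) ==> (enum_val x i == enum_val b i)].
Proof.
rewrite -(inj_eq enum_val_inj) enum_val_indexB.
apply/eqP/forallP => [<- i|xb].
  by apply/implyP => /negPf geiA; rewrite ffunE geiA.
apply/ffunP => i; rewrite ffunE; case: ifPn => [ltiA|geiA].
  by rewrite Bset_lo.
by have := xb i; rewrite geiA => /eqP.
Qed.

(** The mode-by-mode condition of [ptrA_entry] splits into equality of the A-parts on the modes
    below [lA] and two B-part conditions on the other modes. *)
Lemma ptrAE (R : realType) (sigma : 'M[R[i]]_#|occset L N|) :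
  ptrA lA sigma =
  partial_trace (fun x => partA (enum_val x)) indexB sigma.
Proof.
apply/matrixP => b b'; rewrite !mxE; apply: eq_bigr => x _.
apply: eq_bigr => y _; congr (if _ then _ else _); rewrite !indexB_eq.
apply/forallP/and3P => [xy|[/eqP/ffunP xy /forallP xb /forallP yb'] i].
  split; last 2 first.
  - by apply/forallP => i; apply/implyP => geiA; have := xy i;
      rewrite (negPf geiA) => /andP[].
  - by apply/forallP => i; apply/implyP => geiA; have := xy i;
      rewrite (negPf geiA) => /andP[].
  apply/eqP/ffunP => i; rewrite !ffunE; case: ifP => // ltiA.
  by have := xy i; rewrite ltiA => /eqP.
case: ifPn => [ltiA|geiA]; first by have := xy i; rewrite !ffunE ltiA => ->.
by have := xb i; have := yb' i; rewrite geiA /= => -> ->.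
Qed.

Lemma partA_indexB_inj :
  injective (fun x : 'I_#|occset L N| => (partA (enum_val x), indexB x)).
Proof.
move=> x y [/ffunP xyA /(congr1 enum_val)]; rewrite !enum_val_indexB.
move=> /ffunP xyB; apply: enum_val_inj; apply/ffunP => i.
by have := xyA i; have := xyB i; rewrite !ffunE; case: ifP.
Qed.

(** The total being [N], a B-part fixes the particle number of every compatible A-part. *)
Definition sectorA (b : 'I_#|Bset lA L N|) : nat :=
  (N - \sum_i (enum_val b i : nat))%N.

Hypotheses (lA_gt0 : (0 < lA)%N) (ltAL : (lA < L)%N).

Local Notation loA := [set i : 'I_L | (i < lA)%N].

Lemma card_loA : #|loA| = lA.
Proof.
rewrite -[RHS]card_ord -!sum1_card (big_ord_widen L (fun=> 1%N)) 1?ltnW //.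
by apply: eq_bigl => i; rewrite inE.
Qed.

Lemma sum_loA (F : 'I_L -> nat) :
  (\sum_i F i = \sum_(i in loA) F i + \sum_(i in ~: loA) F i)%N.
Proof.
rewrite (bigID (mem loA)) /=; congr (_ + _)%N.
by apply: eq_bigl => i; rewrite !inE.
Qed.

(** Stars and bars on the modes of A, the occupations on B being frozen to those of [b]. *)
Lemma card_indexB b : #|[pred x | indexB x == b]| = dimA lA (sectorA b).
Proof.
have -> : dimA lA (sectorA b) = 'C(lA.-1 + sectorA b, lA.-1).
  by rewrite /dimA; congr ('C(_, _)); lia.
rewrite -(@card_ffun_sum _ loA N _ _ (enum_val b)) ?card_loA ?prednK ?leq_subr //.
transitivity #|[set f in occset L N |
    [forall i, (i \notin loA) ==> (f i == enum_val b i)]]|.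
  rewrite -[RHS]sum1_card.
  rewrite (eq_bigl (fun f => (f \in occset L N) &&
     [forall i, (i \notin loA) ==> (f i == enum_val b i)])); last first.
    by move=> f; rewrite inE.
  rewrite big_enum_val_cond -[LHS]sum1_card; apply: eq_bigl => x.
  by rewrite inE indexB_eq; apply: eq_forallb => i; rewrite !inE.
apply: eq_card => f; rewrite !inE andbC; apply: andb_id2l => /forallP fb.
rewrite sum_loA /sectorA.
have -> : (\sum_(i in ~: loA) f i = \sum_i enum_val b i)%N.
  rewrite [RHS]sum_loA [X in (X + _)%N]big1 ?add0n => [|i]; last first.
    by rewrite inE => ltiA; rewrite Bset_lo.
  apply: eq_bigr => i; rewrite inE => iA; have := fb i; rewrite iA.
  by move=> /eqP ->.
(* [Bset_le] rules out truncation in the subtraction from [N]. *)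
move: (Bset_le b); move: (\sum_i _)%N (\sum_(i in _) _)%N => p q lep.
by apply/eqP/eqP; lia.
Qed.

(** Stars and bars on the modes of B, which hold the [N - nA] particles left by A. *)
Lemma card_sectorA (nA : nat) : (nA <= N)%N ->
  #|[pred b | sectorA b == nA]| = dimB lA L N nA.
Proof.
move=> lenA.
have -> : dimB lA L N nA = 'C((L - lA).-1 + (N - nA), (L - lA).-1).
  by rewrite /dimB; congr ('C(_, _)); lia.
have cardC : #|~: loA| = (L - lA).-1.+1.
  by rewrite cardsCs setCK card_ord card_loA prednK // subn_gt0.
rewrite -(@card_ffun_sum _ (~: loA) N _ _ [ffun=> ord0]) ?leq_subr //.
transitivity #|[set f in Bset lA L N | (N - \sum_i (f i : nat) == nA)%N]|.
  rewrite -[RHS]sum1_card.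
  rewrite (eq_bigl (fun f : occ => (f \in Bset lA L N) &&
     (N - \sum_i (f i : nat) == nA)%N)); last by move=> f; rewrite inE.
  by rewrite big_enum_val_cond -[LHS]sum1_card; apply: eq_bigl => b; rewrite inE.
apply: eq_card => f; rewrite !inE -andbA.
have -> : [forall i, (i \notin ~: loA) ==> (f i == [ffun=> ord0] i)] =
   [forall i : 'I_L, (i < lA)%N ==> (f i == ord0)].
  by apply: eq_forallb => i; rewrite !inE negbK ffunE.
apply: andb_id2l => /forallP f0.
rewrite sum_loA [X in (X + _)%N]big1 ?add0n => [|i].
  move: (\sum_(i in _) _)%N => q.
  by apply/andP/eqP => [[leq /eqP]|eq_q]; [lia | split; [lia|apply/eqP; lia]].
by rewrite inE => iA; have := f0 i; rewrite iA => /eqP ->.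
Qed.

End Fock.

(** * Sectors ordered by the dimension of their A-factor *)

(** For [u k = d_{A,k}] and [v k = d_{B,k}] this lists the fibre sizes of the B-parts, sector after
    sector. *)
Definition blocks (u v : nat -> nat) (K : nat) : seq nat :=
  flatten [seq nseq (v k) (u k) | k <- iota 0 K].

Section Blocks.
Context (u v : nat -> nat).

Lemma blocksS K : blocks u v K.+1 = blocks u v K ++ nseq (v K) (u K).
Proof. by rewrite /blocks -addn1 iotaD map_cat flatten_cat /= cats0. Qed.

Lemma size_blocks K : size (blocks u v K) = (\sum_(k < K) v k)%N.
Proof.
elim: K => [|K IHK]; first by rewrite big_ord0.
by rewrite blocksS size_cat IHK size_nseq big_ord_recr.
Qed.

Lemma nth_blocks K k i : (k < K)%N -> (i < v k)%N ->
  nth 0 (blocks u v K) (\sum_(j < k) v j + i) = u k.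
Proof.
elim: K => // K IHK; rewrite ltnS leq_eqVlt => /predU1P[->|ltkK] ltiv.
  rewrite blocksS nth_cat size_blocks ltnNge leq_addr /= addKn nth_nseq.
  by rewrite ltiv.
rewrite blocksS nth_cat size_blocks IHK // ifT //.
rewrite -(big_mkord xpredT v) -[X in (_ < X)%N](big_mkord xpredT v).
rewrite [X in (_ < X)%N](big_cat_nat (n := k.+1)) //=.
rewrite [X in (_ < X + _)%N]big_nat_recr //= -addnA ltn_add2l.
by rewrite (leq_trans ltiv) // leq_addr.
Qed.

(** This locates the start of the [i]-th chunk of sector [k] in the eigenvalue list: the offset of
    the group plus [i] chunks of length [u k]. *)
Lemma sum_nth_blocks K k i : (k < K)%N -> (i <= v k)%N ->
  (\sum_(r < \sum_(j < k) v j + i) nth 0 (blocks u v K) r =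
   \sum_(j < k) u j * v j + i * u k)%N.
Proof.
move=> ltkK leiv; rewrite big_split_ord /= -sum_chunks; congr (_ + _)%N.
  apply: eq_bigr => j _; rewrite /chunk_sum.
  rewrite (eq_bigr (fun=> u j)) ?sum_nat_const ?card_ord 1?mulnC // => r _.
  by rewrite nth_blocks // (ltn_trans (ltn_ord j)).
rewrite (eq_bigr (fun=> u k)) ?sum_nat_const ?card_ord // => r _.
by rewrite nth_blocks // (leq_trans (ltn_ord r)).
Qed.

Lemma blocks_homo K :
  (forall k k', (k <= k')%N -> (k' < K)%N -> (u k' <= u k)%N) ->
  {homo nth 0%N (blocks u v K) : i j / (i <= j)%N >-> (j <= i)%N}.
Proof.
move=> u_noninc; apply: (@sorted_nth_homo _ geq) => //.
- by move=> x y z /[swap]; apply: leq_trans.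
- by move=> x; rewrite /= leqnn.
rewrite sorted_pairwise; last by move=> x y z /[swap]; apply: leq_trans.
elim: K u_noninc => // K IHK u_noninc; rewrite blocksS pairwise_cat.
apply/and3P; split.
- apply/allrelP => x y /flatten_mapP[k]; rewrite mem_iota add0n => /andP[_ ltkK].
  rewrite !mem_nseq => /andP[_ /eqP->] /andP[_ /eqP->].
  by apply: u_noninc => //; apply: ltnW.
- by apply: IHK => k k' lekk' ltk'K; apply: u_noninc => //; apply: ltnW.
elim: (v K) => //= j ->; rewrite andbT; apply/allP => x /nseqP[-> _].
exact: leqnn.
Qed.

Lemma sum_blocks (R : nmodType) (F : nat -> R) K :
  \sum_(r < size (blocks u v K)) F r =
  \sum_(k < K) \sum_(i < v k) F (\sum_(j < k) v j + i)%N.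
Proof. by rewrite size_blocks -(sum_chunks F v). Qed.

End Blocks.

Lemma count_blocks (u v : nat -> nat) (a : pred nat) (K : nat) :
  (count a (blocks u v K) = \sum_(k < K) v k * a (u k))%N.
Proof.
elim: K => [|K IHK]; first by rewrite big_ord0.
by rewrite blocksS count_cat IHK count_nseq big_ord_recr /= mulnC.
Qed.

(** [inord] extends the dimensions to all of [nat], as [blocks] expects; only indices up to [N] are
    read. *)
Definition sizeA (lA N : nat) (s : {perm 'I_N.+1}) (k : nat) : nat :=
  dimA lA (s (inord k)).
Definition sizeB (lA L N : nat) (s : {perm 'I_N.+1}) (k : nat) : nat :=
  dimB lA L N (s (inord k)).

(** The two lists have equal counts for every predicate: the B-states are grouped by the rank of
    their sector under [s], and [card_sectorA] counts each group. *)
Lemma perm_eq_blocks_sectorA (lA L N : nat) (s : {perm 'I_N.+1}) :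
  (0 < lA)%N -> (lA < L)%N ->
  perm_eq (blocks (sizeA lA s) (sizeB lA L s) N.+1)
    [seq dimA lA (sectorA b) | b : 'I_#|Bset lA L N|].
Proof.
move=> lA_gt0 ltAL; apply/seq.permP => a.
rewrite count_blocks -sum1_count big_map big_enum_cond /=.
rewrite [RHS]big_mkcond /=.
rewrite (partition_big (fun b : 'I_#|Bset lA L N| =>
  (s^-1)%g (inord (sectorA b))) xpredT) //=.
apply: eq_bigr => k _; rewrite /sizeA /sizeB inord_val.
have sec (b : 'I_#|Bset lA L N|) :
    ((s^-1)%g (inord (sectorA b)) == k) = (sectorA b == s k).
  rewrite -(inj_eq (@perm_inj _ s)) permKV -val_eqE /= inordK //.
  by rewrite ltnS; apply: leq_subr.
rewrite -(card_sectorA lA_gt0 ltAL) ?leq_ord // -sum_nat_const.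
by apply: eq_big => b; rewrite inE ?sec // => /eqP ->; case: (a _).
Qed.

(** The pair of sector [k] and index [i] becomes the single index
    [\sum_(j < k) sizeB lA L s j + i]. *)
Lemma min_entropy_formulaE (R : realType) (b : R) (lA L N : nat)
    (s : {perm 'I_N.+1}) (ps : seq R) :
  let cs := blocks (sizeA lA s) (sizeB lA L s) N.+1 in
  min_entropy_formula b lA L s ps =
  - \sum_(r < size cs) chunk_sum (nth 0 ps) (nth 0%N cs) r *
      logb b (chunk_sum (nth 0 ps) (nth 0%N cs) r).
Proof.
move=> cs; rewrite /min_entropy_formula; congr (- _).
rewrite (sum_blocks _ _ (fun r => chunk_sum (nth 0 ps) (nth 0%N cs) r *
      logb b (chunk_sum (nth 0 ps) (nth 0%N cs) r))).
apply: eq_bigr => k _.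
have sizeA_ord j : sizeA lA s (nat_of_ord j) = dimA lA (s j).
  by rewrite /sizeA inord_val.
have sizeB_ord j : sizeB lA L s (nat_of_ord j) = dimB lA L N (s j).
  by rewrite /sizeB inord_val.
rewrite sizeB_ord; apply: eq_bigr => i _.
have lti : (i < sizeB lA L s k)%N by rewrite sizeB_ord.
have -> : \sum_(a < dimA lA (s k))
      nth 0 ps
        (\sum_(j < N.+1 | (j < k)%N) dimA lA (s j) * dimB lA L N (s j) +
         i * dimA lA (s k) + a)%N =
    chunk_sum (nth 0 ps) (nth 0%N cs) (\sum_(j < k) sizeB lA L s j + i)%N.
  rewrite /chunk_sum nth_blocks // sum_nth_blocks // 1?ltnW //.
  rewrite (big_ord_widen N.+1 (fun j => sizeA lA s j * sizeB lA L s j)%N) 1?ltnW //.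
  rewrite -sizeA_ord; apply: eq_bigr => a _; congr (nth _ _ (_ + _ + _)%N).
  by apply: eq_bigr => j _; rewrite sizeA_ord sizeB_ord.
by [].
Qed.

(** * Minimization over the unitaries of the N-particle space *)

Theorem theorem1 (R : realType) (b : R) (hb : 1 < b) (N L lA : nat)
  (hL : (2 <= L)%N) (hlA1 : (1 <= lA)%N) (hlA2 : (lA <= L - 1)%N)
  (rho : 'M[R[i]]_#|occset L N|) (hrho : density_op rho)
  (ps : seq R) (hsize : size ps = #|occset L N|)
  (hsorted : sorted (fun x y : R => y <= x) ps)
  (heig : char_poly rho = \prod_(x <- ps) ('X - ((x%:C)%C)%:P))
  (s : {perm 'I_N.+1})
  (hs : forall k k' : 'I_N.+1, (k <= k')%N -> (dimA lA (s k') <= dimA lA (s k))%N) :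
  (exists U : 'M[R[i]]_#|occset L N|, U \is unitarymx /\
     vN_entropy b (ptrA lA (U *m rho *m U ^t*)) = min_entropy_formula b lA L s ps) /\
  (forall U : 'M[R[i]]_#|occset L N|, U \is unitarymx ->
     min_entropy_formula b lA L s ps <= vN_entropy b (ptrA lA (U *m rho *m U ^t*))).
Proof.
have ltAL : (lA < L)%N by lia.
have [rho_herm rho_psd _] := hrho.
have [||W W_unit rhoE] := unitary_diagonalization
    (ds := [seq (x%:C)%C | x <- ps]) rho_herm.
- by rewrite size_map.
- by rewrite heig big_map.
pose p := nth 0 ps.
have {}rhoE : rho = W^t* *m diag_mx (\row_i ((p i)%:C)%C) *m W.
  rewrite rhoE; congr (_ *m diag_mx _ *m _); apply/rowP => i; rewrite !mxE.
  by rewrite (nth_map 0) // hsize.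
(* Positivity of [rho] is tested on its eigenvectors, the columns of the adjoint of [W]. *)
have ps_ge0 : {in ps, forall x, 0 <= x}.
  move=> x x_ps; have lti : (index x ps < #|occset L N|)%N.
    by rewrite -hsize index_mem.
  pose i' := Ordinal lti; rewrite -(nth_index 0 x_ps).
  rewrite -[nth 0 ps _]/(p i').
  rewrite -ler0c; have := rho_psd (col i' (W^t*)).
  have -> : (col i' (W^t*))^t* = row i' W.
    by apply/matrixP => x' y; rewrite !mxE conjCK.
  rewrite -row_mul colE mulmxA -row_mul -colE mxE mxE.
  rewrite {1}rhoE !mulmxA (unitarymxP W_unit) mul1mx -mulmxA (unitarymxP W_unit).
  by rewrite mulmx1 !mxE eqxx mulr1n.
have p_noninc : {homo p : i j / (i <= j)%N >-> j <= i}.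
  apply: (@sorted_nth_homo _ (fun x y : R => y <= x)) => //.
  by move=> x y z xy /le_trans; apply.
have p_ge0 i : 0 <= p i.
  have [lti|lei] := ltnP i (size ps); first exact/ps_ge0/mem_nth.
  by rewrite /p nth_default.
pose cs := blocks (sizeA lA s) (sizeB lA L s) N.+1.
have cs_perm := perm_eq_blocks_sectorA s hlA1 ltAL.
have szcs : size cs == #|Bset lA L N|.
  by rewrite (perm_size cs_perm) size_map size_enum_ord.
(* [t] assigns to position [r] of [cs] a B-state whose fibre has that size. *)
have /tuple_permP[t csE] : perm_eq (Tuple szcs)
    [tuple dimA lA (sectorA b) | b < #|Bset lA L N|] by [].
have cE (r : 'I_#|Bset lA L N|) :
    nth 0%N cs r = #|[pred x | indexB lA x == t r]|.
  rewrite card_indexB // -[cs]/(tval (Tuple szcs)) csE.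
  by rewrite (nth_map r) ?size_enum_ord // nth_ord_enum tnth_mktuple.
have c_noninc : {homo nth 0%N cs : i j / (i <= j)%N >-> (j <= i)%N}.
  apply: blocks_homo => k k' lekk' ltk'N; apply: hs.
  by rewrite !inordK // (leq_ltn_trans lekk').
have AB_inj := @partA_indexB_inj lA L N.
rewrite min_entropy_formulaE -/cs (eqP szcs); split=> [|U U_unit].
  have [U U_unit UE] := vN_entropy_partial_trace_attained b
    (fun x => partA lA (enum_val x)) p W_unit cE.
  by exists U; split; rewrite // ptrAE rhoE.
(* Conjugation by [U] only changes the eigenbasis, so the lower bound applies with the same [p]. *)
have -> : U *m rho *m U^t* =
    (W *m U^t*)^t* *m diag_mx (\row_i ((p i)%:C)%C) *m (W *m U^t*).
  by rewrite trmx_mul map_mxM /= trmxCK rhoE !mulmxA.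
rewrite ptrAE; apply: vN_entropy_partial_trace_ge cE => //.
by rewrite mul_unitarymx // trmxC_unitary.
Qed.
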